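(* For any positive integers $m$ and $n$, $$\gcd\left(\sum_{k=0}^{2n}(-1)^k\binom{2n}{k}^r:\ r=m,m+1,m+2,\ldots\right)=\binom{2n}{n}.$$
   Context: $\gcd(a_1,a_2,\ldots)$ denotes the greatest common divisor of the (infinitely many) integers $a_1,a_2,\ldots$, i.e. the nonnegative generator of the ideal of $\mathbb{Z}$ they generate. *)

(* Defs.v *)
From HB Require Import structures.
From mathcomp Require Import all_boot all_order all_algebra.

Set Implicit Arguments.
Unset Strict Implicit.
Unset Printing Implicit Defensive.

Import Order.TTheory GRing.Theory Num.Theory.
Local Open Scope ring_scope.

Definition gen_ideal (a : nat -> int) (x : int) : Prop :=
  exists (N : nat) (c : nat -> int), x = \sum_(i < N) c i * a i.

(* [is_gcd_seq a g] : g = gcd(a_0, a_1, ...), the nonnegative generator of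
   the ideal of the integers generated by all the a_i; it determines g by
   [is_gcd_seq_unique]. *)
Definition is_gcd_seq (a : nat -> int) (g : int) : Prop :=
  0 <= g /\ forall x : int, gen_ideal a x <-> exists q : int, x = q * g.

Lemma is_gcd_seq_unique (a : nat -> int) (g h : int) :
  is_gcd_seq a g -> is_gcd_seq a h -> g = h.
Proof.
move=> [g0 Hg] [h0 Hh].
have hg : (h %| g)%Z.
  by apply/dvdzP; apply/Hh/Hg; exists 1; rewrite mul1r.
have gh : (g %| h)%Z.
  by apply/dvdzP; apply/Hg/Hh; exists 1; rewrite mul1r.
rewrite -(gez0_abs g0) -(gez0_abs h0); congr Posz.
by apply/eqP; rewrite eqn_dvd; apply/andP.
Qed.

Definition alt_binom_power_sum (n r : nat) : int :=
  \sum_(0 <= k < (2 * n).+1) (-1) ^+ k * ('C(2 * n, k)%:Z) ^+ r.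

(* Main.v *)
(** Centre the sum at k = n and normalise the binomials as 1/((i-k)!(i+k)!).
    The Vandermonde identity expands the product of such a function for i by
    'C(2n, n+k) as a combination of those for j <= i.  Iterating this gives, with
    the sum for r = 1 equal to 0,
      \sum_k (-1)^k 'C(2n, k)^r = (-1)^n 'C(2n, n) v_(r-2)(n)   for r >= 2,
    where v_0 = 1 and v_(s+1)(i) = \sum_(j <= i) 'C(i, j) 'C(2n, n-j) v_s(j).
    Hence 'C(2n, n) divides every sum.  The cofactors v_s(n) with s large have no
    common prime divisor p: modulo p the recursion is invertible on the
    coordinates j with p not dividing 'C(2n, n-j), which include j = n, so v is
    periodic there and v_s(n) = v_0(n) = 1 modulo p for arbitrarily large s. *)

Require Import Defs.
From HB Require Import structures.
From mathcomp Require Import all_boot all_order all_algebra.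
From mathcomp Require Import zify ring.
Import Order.TTheory GRing.Theory Num.Theory.
Local Open Scope ring_scope.

(** * Ideals of integers generated by a sequence *)

Lemma gen_ideal_gen (a : nat -> int) (i : nat) : gen_ideal a (a i).
Proof.
exists i.+1, (fun j => (j == i)%:R).
rewrite big_ord_recr /= eqxx mul1r big1 ?add0r // => j _.
by rewrite ltn_eqF ?mul0r.
Qed.

Lemma gen_ideal_comb (a : nat -> int) (u v x y : int) :
  gen_ideal a x -> gen_ideal a y -> gen_ideal a (u * x + v * y).
Proof.
have pad N M (c : nat -> int) : (N <= M)%N ->
    \sum_(i < N) c i * a i = \sum_(i < M) (if (i < N)%N then c i else 0) * a i.
  move=> leNM; rewrite (big_ord_widen _ (fun i => c i * a i) leNM) big_mkcond /=.
  by apply: eq_bigr => i _; case: ifP => //; rewrite mul0r.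
move=> [N [c ->]] [M [e ->]].
rewrite (pad _ (N + M)%N c) ?leq_addr // (pad _ (N + M)%N e) ?leq_addl //.
exists (N + M)%N, (fun i => u * (if (i < N)%N then c i else 0)
                          + v * (if (i < M)%N then e i else 0)).
rewrite !mulr_sumr -big_split; apply: eq_bigr => i _ /=.
by rewrite mulrDl !mulrA.
Qed.

(** Descent on the absolute value of a nonzero [x] in the ideal: a prime factor of [x] fails to
    divide some [a j], so [gcdz x (a j)] is strictly smaller, and Bezout keeps it in the ideal. The
    prime 2 supplies a nonzero start. *)
Lemma gen_ideal_one (a : nat -> int) :
  (forall p : nat, prime p -> exists j, ~~ (p%:Z %| a j)%Z) -> gen_ideal a 1.
Proof.
move=> coprime_a.
have [j0 ndvd_j0] := coprime_a 2%N isT.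
have aj0 : a j0 != 0 by apply: contraNneq ndvd_j0 => ->; rewrite dvdz0.
move: (a j0) aj0 (gen_ideal_gen a j0) => {j0 ndvd_j0} x.
have [k] := ubnP `|x|%N; elim: k x => // k IH x le_xk x_neq0 ideal_x.
have [x_unit | x_nunit] := eqVneq `|x|%N 1%N.
  have <- : x * x + 0 * x = 1%R by nia.
  exact: gen_ideal_comb.
have x_gt1 : (1 < `|x|)%N by lia.
have [j ndvd_j] := coprime_a _ (pdiv_prime x_gt1).
have [u [v def_g]] := Bezoutz x (a j).
apply: (IH (gcdz x (a j))).
- have lt_gx : (gcdn `|x| `|a j| < `|x|)%N.
    rewrite ltn_neqAle (dvdn_leq (ltnW x_gt1)) ?dvdn_gcdl // andbT.
    apply: contra ndvd_j => /eqP def_x.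
    apply: (dvdn_trans (pdiv_dvd _)); rewrite -def_x; exact: dvdn_gcdr.
  exact: leq_trans lt_gx le_xk.
- by rewrite gcdz_eq0 negb_and x_neq0.
- by rewrite -def_g; apply: gen_ideal_comb (gen_ideal_gen a j).
Qed.

(** * The cofactors and their periodicity modulo a prime *)

Fixpoint chain_sum (d : nat -> nat) (r i : nat) : nat :=
  if r is r'.+1 then \sum_(j < i.+1) 'C(i, j) * d j * chain_sum d r' j else 1.

(* Modulo p, the coordinates j with p | d j never contribute, and on the other
   ones the triangular transfer matrix is invertible, so chain_sum is purely
   periodic there and returns to its initial value 1. *)
Lemma chain_sum_ndvd (d : nat -> nat) (n p m : nat) :
  prime p -> ~~ (p %| d n)%N ->
  exists2 r, (m <= r)%N & ~~ (p %| chain_sum d r n)%N.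
Proof.
move=> pr_p ndvd_dn.
have dvdF k : ((k%:R : 'F_p) == 0) = (p %| k)%N.
  by rewrite (dvdn_pcharf (pchar_Fp pr_p)).
(* Coordinates with [p] dividing [d i] are left fixed, which makes [f] injective on a finite
   type. *)
pose f (v : {ffun 'I_n.+1 -> 'F_p}) := [ffun i : 'I_n.+1 =>
  if (p %| d i)%N then v i
  else \sum_(j < n.+1) ('C(i, j) * d j)%:R * v j].
have f_inj : injective f.
  move=> v w /ffunP eq_f; apply/ffunP => i.
  have [k] := ubnP (i : nat); elim: k i => // k IH i le_ik.
  have := eq_f i; rewrite !ffunE; case: ifP => // /negbT ndvd_i.
  rewrite (bigD1 i) //= [X in _ = X](bigD1 i) //= binn mul1n.
  rewrite (eq_bigr (fun j : 'I_n.+1 => ('C(i, j) * d j)%:R * w j)) => [|j neq_ji].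
    by move/addIr/(mulfI _); apply; rewrite dvdF.
  have [lt_ji | le_ij] := ltnP j i.
    by rewrite IH // (leq_trans lt_ji).
  by rewrite bin_small ?mul0n ?mul0r // ltn_neqAle le_ij eq_sym andbT.
pose x0 : {ffun 'I_n.+1 -> 'F_p} := [ffun=> 1].
have iterE r (i : 'I_n.+1) : ~~ (p %| d i)%N ->
    iter r f x0 i = (chain_sum d r i)%:R.
  elim: r i => [|r IH] i ndvd_i /=; first by rewrite ffunE.
  rewrite ffunE (negbTE ndvd_i) natr_sum.
  rewrite (big_ord_widen n.+1
    (fun j => ('C(i, j) * d j * chain_sum d r j)%:R : 'F_p) (ltn_ord i)).
  rewrite [RHS]big_mkcond /=.
  apply: eq_bigr => j _; rewrite ltnS.
  case: leqP => [_ | lt_ij]; last by rewrite bin_small ?mul0n ?mul0r.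
  (* On the fixed coordinates the iterate may differ from [chain_sum], but their coefficient is 0
     modulo [p]. *)
  have [dvd_j | ndvd_j] := boolP (p %| d j)%N; last by rewrite IH // -natrM.
  have /eqP z1 : (('C(i, j) * d j)%:R : 'F_p) == 0 by rewrite dvdF dvdn_mull.
  by rewrite [RHS]natrM z1 !mul0r.
exists (m * order f x0)%N; first by rewrite leq_pmulr // order_gt0.
rewrite -dvdF -(iterE _ ord_max) //.
have -> : iter (m * order f x0) f x0 = x0.
  by elim: (m) => // k IH; rewrite mulSn addnC iterD iter_order.
by rewrite ffunE oner_eq0.
Qed.

(** * Normalised central binomials *)

Lemma fact_neq0 (m : nat) : m`!%:R != 0 :> rat.
Proof. by rewrite pnatr_eq0 -lt0n fact_gt0. Qed.

Lemma bin_fact_ratE (m k : nat) : (k <= m)%N ->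
  'C(m, k)%:R = m`!%:R / (k`!%:R * (m - k)`!%:R) :> rat.
Proof.
move=> le_km; rewrite -(bin_fact le_km) !natrM mulfK //.
by rewrite mulf_neq0 ?fact_neq0.
Qed.

(* sym_bin i k = 'C(2 i, i + k) / (2 i)!, defined for |k| only. *)
Definition sym_bin (i k : nat) : rat :=
  if (k <= i)%N then ((i - k)`!%:R * (i + k)`!%:R)^-1 else 0.

(** Only [j = k + s] contributes; clearing factorials leaves Vandermonde for
    ['C((i - k) + (n + k), n - k)]. *)
Lemma sym_bin_mul (n i k : nat) : (i <= n)%N ->
  sym_bin i k * sym_bin n k =
  \sum_(j < i.+1) ((n + i)`!%:R * (i - j)`!%:R * (n - j)`!%:R)^-1 * sym_bin j k.
Proof.
move=> le_in; have [le_ki | lt_ik] := leqP k i; last first.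
  rewrite {1}/sym_bin leqNgt lt_ik mul0r big1 // => j _.
  by rewrite /sym_bin leqNgt (leq_trans (ltn_ord j)) ?mulr0.
rewrite -(big_mkord xpredT (fun j => ((n + i)`!%:R * (i - j)`!%:R * (n - j)`!%:R)^-1 * sym_bin j k)).
rewrite (big_cat_nat _ (n := k)) //=; last by lia.
rewrite big_nat big1 ?add0r => [|j /andP[_ lt_jk]]; last first.
  by rewrite /sym_bin leqNgt lt_jk mulr0.
rewrite (big_addn 0 _ k).
transitivity (((n + i)`!%:R * (i - k)`!%:R * (n + k)`!%:R)^-1 *
    \sum_(0 <= s < i.+1 - k) ('C(i - k, s) * 'C(n + k, n - k - s))%:R : rat).
  have -> : (\sum_(0 <= s < i.+1 - k) ('C(i - k, s) * 'C(n + k, n - k - s))%:R : rat)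
     = 'C(n + i, n - k)%:R.
    have -> : (n + i = (i - k) + (n + k))%N by lia.
    rewrite -binomial.Vandermonde natr_sum.
    rewrite -(big_mkord xpredT (fun s => ('C(i - k, s) * 'C(n + k, n - k - s))%:R : rat)).
    rewrite [RHS](big_cat_nat _ (n := i.+1 - k)%N) //=; last by lia.
    rewrite [X in _ + X]big_nat [X in _ + X]big1 ?addr0 // => s lt_s.
    by rewrite bin_small ?mul0n //; lia.
  rewrite bin_fact_ratE; last by lia.
  have -> : (n + i - (n - k) = i + k)%N by lia.
  rewrite /sym_bin le_ki (leq_trans le_ki le_in).
  by field; rewrite !fact_neq0.
rewrite mulr_sumr; apply: eq_big_nat => s /andP[_ lt_s].
rewrite /sym_bin leq_addl addnK natrM !bin_fact_ratE; try lia.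
have -> : (n + k - (n - k - s) = s + k + k)%N by lia.
have -> : (i - (s + k) = i - k - s)%N by lia.
have -> : (n - (s + k) = n - k - s)%N by lia.
by field; rewrite !fact_neq0.
Qed.

(* The sum of truncated subtractions is |K - n|. *)
Definition centre_dist (n K : nat) : nat := (K - n) + (n - K).

Lemma bin_centre (n K : nat) : (K <= 2 * n)%N ->
  'C(2 * n, K)%:R = (2 * n)`!%:R * sym_bin n (centre_dist n K).
Proof.
move=> le_K; rewrite bin_fact_ratE // /sym_bin /centre_dist.
have -> : ((K - n) + (n - K) <= n)%N by lia.
have [le_nK | lt_Kn] := leqP n K.
  have -> : (n - (K - n + (n - K)) = 2 * n - K)%N by lia.
  have -> : (n + (K - n + (n - K)) = K)%N by lia.
  by rewrite [X in _ / X]mulrC.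
have -> : (n - (K - n + (n - K)) = K)%N by lia.
by have -> : (n + (K - n + (n - K)) = 2 * n - K)%N by lia.
Qed.

(** The support is [n - i <= K <= n + i]; shifted to 0, the sum is [(1 - 1) ^ (2 * i)] up to sign
    and [(2 * i)!]. *)
Lemma sum_alt_sym_bin (n i : nat) : (i <= n)%N ->
  \sum_(K < (2 * n).+1) (-1) ^+ K * sym_bin i (centre_dist n K) =
  (-1) ^+ n * (i == 0)%:R.
Proof.
move=> le_in.
rewrite -(big_mkord xpredT (fun K => (-1) ^+ K * sym_bin i (centre_dist n K))).
rewrite (big_cat_nat _ (n := (n - i)%N)) //=; last by lia.
rewrite big_nat big1 ?add0r => [|K lt_K]; last first.
  by rewrite /sym_bin /centre_dist ifN ?mulr0 //; lia.
rewrite (big_cat_nat _ (n := (n + i).+1)) //=; [|lia|lia].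
rewrite [X in _ + X]big_nat [X in _ + X]big1 ?addr0 => [|K lt_K]; last first.
  by rewrite /sym_bin /centre_dist ifN ?mulr0 //; lia.
rewrite (big_addn 0 _ (n - i)).
have -> : ((n + i).+1 - (n - i) = (2 * i).+1)%N by lia.
transitivity ((-1) ^+ (n - i) / (2 * i)`!%:R * (1 + (-1)) ^+ (2 * i) : rat).
  rewrite exprDn mulr_sumr big_mkord; apply: eq_bigr => s _.
  have le_s : (s <= 2 * i)%N by rewrite -ltnS.
  rewrite expr1n mul1r exprD -[_ *+ 'C(_, _)]mulr_natr bin_centre //.
  have -> : centre_dist n (s + (n - i)) = centre_dist i s.
    by rewrite /centre_dist; lia.
  by field; rewrite fact_neq0.
rewrite subrr; case: (posnP i) => [-> | i_gt0].
  by rewrite subn0 muln0 expr0 fact0 divr1.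
by rewrite expr0n muln_eq0 /= gtn_eqF // !mulr0.
Qed.

(** One factor keeps a free index [i], so that a recursion on [r] closes; [i = n] recovers the
    original sum. *)
Definition weighted_sum (n r i : nat) : rat :=
  \sum_(K < (2 * n).+1)
    (-1) ^+ K * 'C(2 * n, K)%:R ^+ r * sym_bin i (centre_dist n K).

Lemma weighted_sumS (n r i : nat) : (i <= n)%N ->
  weighted_sum n r.+1 i =
  \sum_(j < i.+1) (2 * n)`!%:R / ((n + i)`!%:R * (i - j)`!%:R * (n - j)`!%:R)
                  * weighted_sum n r j.
Proof.
move=> le_in; under [RHS]eq_bigr => j _ do rewrite mulr_sumr.
rewrite exchange_big; apply: eq_bigr => K _ /=.
have le_K : (K <= 2 * n)%N by rewrite -ltnS.
transitivity ((-1) ^+ K * 'C(2 * n, K)%:R ^+ r * (2 * n)`!%:R *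
   (sym_bin i (centre_dist n K) * sym_bin n (centre_dist n K))).
  by rewrite exprSr [X in _ * (_ * X)]bin_centre //; ring.
by rewrite sym_bin_mul // mulr_sumr; apply: eq_bigr => j _; ring.
Qed.

(** The prefactor turns the coefficients of [weighted_sumS] into ['C(i, j) * 'C(2 * n, n - j)]. At
    [r = 0] only [j = 0] survives. *)
Lemma weighted_sum_chain (n r i : nat) : (i <= n)%N ->
  weighted_sum n r.+1 i =
  (-1) ^+ n * (2 * n)`!%:R / ((n + i)`!%:R * i`!%:R * n`!%:R)
  * (chain_sum (fun j => 'C(2 * n, n - j)) r i)%:R.
Proof.
elim: r i => [|r IH] i le_in; rewrite weighted_sumS //.
  have ws0 j : (j <= n)%N -> weighted_sum n 0 j = (-1) ^+ n * (j == 0)%:R.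
    move=> le_jn; rewrite -sum_alt_sym_bin //; apply: eq_bigr => K _.
    by rewrite expr0 mulr1.
  rewrite big_ord_recl big1 => [|j _]; last first.
    by rewrite ws0 ?mulr0 //= /bump; have := ltn_ord j; lia.
  by rewrite ws0 //= !subn0; ring.
rewrite /= natr_sum mulr_sumr; apply: eq_bigr => j _.
have le_ji : (j <= i)%N by rewrite -ltnS.
rewrite IH ?(leq_trans le_ji) // !natrM !bin_fact_ratE //; last by lia.
have -> : (2 * n - (n - j) = n + j)%N by lia.
by field; rewrite !fact_neq0.
Qed.

Lemma alt_binom_power_sum_weighted (n r : nat) :
  (alt_binom_power_sum n r.+1)%:~R = (2 * n)`!%:R * weighted_sum n r n.
Proof.
rewrite /alt_binom_power_sum big_mkord rmorph_sum mulr_sumr.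
apply: eq_bigr => K _; have le_K : (K <= 2 * n)%N by rewrite -ltnS.
rewrite rmorphM !rmorphXn /= rmorphN1 -pmulrn exprSr.
by rewrite [X in _ * (_ * X)]bin_centre //; ring.
Qed.

Lemma alt_binom_power_sum1 (n : nat) :
  (0 < n)%N -> alt_binom_power_sum n 1 = 0.
Proof.
move=> n_gt0; apply: (@intr_inj rat); rewrite alt_binom_power_sum_weighted.
rewrite /weighted_sum; under eq_bigr => K _ do rewrite expr0 mulr1.
by rewrite sum_alt_sym_bin // gtn_eqF // !mulr0.
Qed.

Lemma alt_binom_power_sumSS (n r : nat) :
  alt_binom_power_sum n r.+2 =
  (-1) ^+ n * (chain_sum (fun j => 'C(2 * n, n - j)) r n)%:Z * 'C(2 * n, n)%:Z.
Proof.
apply: (@intr_inj rat); rewrite alt_binom_power_sum_weighted.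
rewrite weighted_sum_chain // !rmorphM rmorphXn /= rmorphN1 -!pmulrn.
rewrite bin_fact_ratE; last by lia.
have -> : (2 * n - n = n)%N by lia.
have -> : (n + n = 2 * n)%N by lia.
by field; rewrite !fact_neq0.
Qed.

Theorem mainTheorem3 (m n : nat) (hm : (0 < m)%N) (hn : (0 < n)%N) :
  is_gcd_seq (fun j : nat => alt_binom_power_sum n (m + j)%N)
             ('C(2 * n, n)%:Z).
Proof.
set d := fun j => 'C(2 * n, n - j).
(* The cofactor of the central binomial; the default 0 fits exponent 1, and exponent 0 is excluded
   by [hm]. *)
pose t j : int := if (m + j)%N is r.+2 then (-1) ^+ n * (chain_sum d r n)%:Z else 0.
have sumE j : alt_binom_power_sum n (m + j)%N = t j * 'C(2 * n, n)%:Z.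
  rewrite /t; case: (m + j)%N (leq_trans hm (leq_addr j m)) => [|[|r]] // _.
    by rewrite alt_binom_power_sum1 ?mul0r.
  by rewrite alt_binom_power_sumSS.
have [N [c def1]] : gen_ideal t 1.
  apply: gen_ideal_one => p pr_p.
  have [|r le_mr ndvd] := @chain_sum_ndvd d n p m pr_p.
    by rewrite /d subnn bin0 Euclid_dvd1.
  (* This index gives exponent [r.+2], whose cofactor is [chain_sum d r n] up to sign. *)
  exists (r.+2 - m)%N; rewrite /t subnKC; last by lia.
  by rewrite dvdzE abszM abszX exp1n mul1n.
split=> // x; split.
  case=> [M [e ->]]; exists (\sum_(i < M) e i * t i); rewrite mulr_suml.
  by apply: eq_bigr => i _; rewrite sumE mulrA.
case=> q ->; exists N, (fun i => q * c i).
rewrite -[LHS]mul1r def1 mulr_suml; apply: eq_bigr => i _.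
by rewrite sumE; ring.
Qed.
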